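(* Fix a triple of positive integers $(r,c,c')$, and let $\Theta=(\theta,\theta',\theta_\infty)\in\mathbb{R}^3$ satisfy $c\theta+c'\theta'+r\theta_\infty=0$. Suppose $\theta'>0$ and $\theta+\theta'<0$. Let $X=(W,V,V',A,B,I,J,A',B',F)$ be a representation of the enhanced ADHM quiver of numerical type $(r,c,c')$. Then the following are equivalent: (i) $X$ is $\Theta$-stable; (ii) $X$ is $\Theta$-semistable; (iii) $X$ satisfies the following conditions: (S.1) $F\in\mathrm{Hom}(V',V)$ is injective; (S.2) the ADHM data $(W,V,A,B,I,J)$ is stable, i.e., there is no proper subspace $0\subseteq S\subsetneq V$ preserved by $A$ and $B$ and containing the image of $I$.
   Context: A representation of the enhanced ADHM quiver of numerical type $(r,c,c')$ is a tuple $X=(W,V,V',A,B,I,J,A',B',F)$, where $W,V,V'$ are complex vector spaces of dimensions $r,c,c'$, and $A,B\in\mathrm{End}(V)$, $I\in\mathrm{Hom}(W,V)$, $J\in\mathrm{Hom}(V,W)$, $A',B'\in\mathrm{End}(V')$, $F\in\mathrm{Hom}(V',V)$ satisfy $$[A,B]+IJ=0,\quad AF-FA'=0,\quad BF-FB'=0,\quad JF=0,\quad [A',B']=0.$$ A subrepresentation $\widetilde X\subseteq X$ is given by a triple of subspaces $(\widetilde W,S,S')$ of $(W,V,V')$ preserved by all the maps: $A(S),B(S)\subseteq S$, $I(\widetilde W)\subseteq S$, $J(S)\subseteq\widetilde W$, $A'(S'),B'(S')\subseteq S'$, $F(S')\subseteq S$. Its numerical type is $(\dim\widetilde W,\dim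 S,\dim S')$. Let $\Theta=(\theta,\theta',\theta_\infty)\in\mathbb{R}^3$ with $c\theta+c'\theta'+r\theta_\infty=0$. A representation $X$ of numerical type $(r,c,c')$ is $\Theta$-stable if - any subrepresentation $0\ne\widetilde X\subset X$ of numerical type $(0,\widetilde c,\widetilde c')$ satisfies $\theta\widetilde c+\theta'\widetilde c'<0$; and - any subrepresentation $\widetilde X\subsetneq X$ of numerical type $(r,\widetilde c,\widetilde c')$ satisfies $\theta_\infty r+\theta\widetilde c+\theta'\widetilde c'<0$. It is $\Theta$-semistable if the same two conditions hold with $<$ replaced by $\le$. *)

(* Defs.v *)
From mathcomp Require Import all_boot all_order all_algebra.
From mathcomp Require Import reals.
From mathcomp Require Import complex.

Set Implicit Arguments.
Unset Strict Implicit.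
Unset Printing Implicit Defensive.

Import Order.TTheory GRing.Theory Num.Theory.
Local Open Scope ring_scope.

Record eadhm_rep (R : realType) (r c c' : nat) := EAdhmRep {
  repW : vectType R[i];
  repV : vectType R[i];
  repV' : vectType R[i];
  dim_repW : \dim {: repW} = r;
  dim_repV : \dim {: repV} = c;
  dim_repV' : \dim {: repV'} = c';
  mapA : 'End(repV);
  mapB : 'End(repV);
  mapI : 'Hom(repW, repV);
  mapJ : 'Hom(repV, repW);
  mapA' : 'End(repV');
  mapB' : 'End(repV');
  mapF : 'Hom(repV', repV);
  adhm_eq : ((mapA \o mapB) - (mapB \o mapA) + (mapI \o mapJ))%VF = 0;
  eqAF : ((mapA \o mapF) - (mapF \o mapA'))%VF = 0;
  eqBF : ((mapB \o mapF) - (mapF \o mapB'))%VF = 0;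
  eqJF : (mapJ \o mapF)%VF = 0;
  eqA'B' : ((mapA' \o mapB') - (mapB' \o mapA'))%VF = 0
}.

Record subrep (R : realType) (r c c' : nat) (X : eadhm_rep R r c c') := Subrep {
  subW : {vspace repW X};
  subV : {vspace repV X};
  subV' : {vspace repV' X};
  subrepA : (mapA X @: subV <= subV)%VS;
  subrepB : (mapB X @: subV <= subV)%VS;
  subrepI : (mapI X @: subW <= subV)%VS;
  subrepJ : (mapJ X @: subV <= subW)%VS;
  subrepA' : (mapA' X @: subV' <= subV')%VS;
  subrepB' : (mapB' X @: subV' <= subV')%VS;
  subrepF : (mapF X @: subV' <= subV)%VS
}.

Definition numtype (R : realType) (r c c' : nat) (X : eadhm_rep R r c c')
    (Y : subrep X) : nat * nat * nat :=
  (\dim (subW Y), \dim (subV Y), \dim (subV' Y)).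

Definition subrep_zero (R : realType) (r c c' : nat) (X : eadhm_rep R r c c')
    (Y : subrep X) : Prop :=
  [/\ subW Y = 0%VS, subV Y = 0%VS & subV' Y = 0%VS].

Definition subrep_full (R : realType) (r c c' : nat) (X : eadhm_rep R r c c')
    (Y : subrep X) : Prop :=
  [/\ subW Y = fullv, subV Y = fullv & subV' Y = fullv].

(* The normalization c * theta + c' * theta' + r * thetaoo = 0 is not built
   into the next two definitions; it has to be assumed where they are used. *)
Definition theta_stable (R : realType) (r c c' : nat) (X : eadhm_rep R r c c')
    (theta theta' thetaoo : R) : Prop :=
  (forall (Y : subrep X) (d d' : nat),
     ~ subrep_zero Y -> numtype Y = (0%N, d, d') ->
     theta * d%:R + theta' * d'%:R < 0) /\
  (forall (Y : subrep X) (d d' : nat),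
     ~ subrep_full Y -> numtype Y = (r, d, d') ->
     thetaoo * r%:R + theta * d%:R + theta' * d'%:R < 0).

Definition theta_semistable (R : realType) (r c c' : nat) (X : eadhm_rep R r c c')
    (theta theta' thetaoo : R) : Prop :=
  (forall (Y : subrep X) (d d' : nat),
     ~ subrep_zero Y -> numtype Y = (0%N, d, d') ->
     theta * d%:R + theta' * d'%:R <= 0) /\
  (forall (Y : subrep X) (d d' : nat),
     ~ subrep_full Y -> numtype Y = (r, d, d') ->
     thetaoo * r%:R + theta * d%:R + theta' * d'%:R <= 0).

(* J takes no part in the stability of ADHM data; it is kept as an argument
   because it belongs to the data. *)
Definition adhm_stable (R : realType) (W V : vectType R[i])
    (A B : 'End(V)) (I : 'Hom(W, V)) (J : 'Hom(V, W)) : Prop :=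
  ~ exists S : {vspace V},
      [/\ S != fullv, (A @: S <= S)%VS, (B @: S <= S)%VS & (limg I <= S)%VS].

(* Main.v *)
Require Import Defs.
From mathcomp Require Import all_boot all_order all_algebra.
From mathcomp Require Import reals.
From mathcomp Require Import complex.
From mathcomp Require Import lra.

Set Implicit Arguments.
Unset Strict Implicit.
Unset Printing Implicit Defensive.

Import Order.TTheory GRing.Theory Num.Theory.
Local Open Scope ring_scope.

(** By the normalization of Theta, a subrepresentation of type (r, d, d') has
    Theta-weight theta * (d - c) + theta' * (d' - c'); so both halves of
    stability only involve theta and theta', and the hypotheses say that theta'
    is positive while theta is negative and dominates it.

    Stability is thus violated by making the V'-component as large as possible
    over a given S in V, that is, equal to the preimage of S under F; this
    preimage is always the V'-component of a subrepresentation
    ([pullback_subrep]).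
    - Over S = 0 one gets (0, 0, ker F), of weight theta' * dim (ker F); since
      theta' is positive, semistability forces F to be injective.
    - Over a proper invariant S containing the image of I one gets
      (W, S, F^-1 S).  The codimension of a preimage is at most that of S
      ([codim_preim]), so the weight is at least - (theta + theta') * codim S,
      which is positive: semistability forces S to be all of V.

    Conversely, if F is injective then every V'-component has dimension d' <= d,
    so a nonzero subrepresentation of type (0, d, d') has weight at most
    (theta + theta') * d < 0; and if the ADHM data are stable then a
    subrepresentation containing W contains V, so, if it is proper, it loses
    only theta' * (c' - d') > 0 from the total weight 0.  As stability trivially
    implies semistability, the three conditions are equivalent. *)

Section LinearAlgebra.
Variables (K : fieldType) (U V : vectType K).
Implicit Types (f : 'Hom(U, V)) (S : {vspace V}).

(** U / f^-1(S) embeds into V / S.  In terms of dimensions, f^-1(S) is an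
    extension of the intersection of S and the image of f by the kernel of f. *)
Lemma codim_preim f S :
  (\dim {:U} + \dim S <= \dim (f @^-1: S) + \dim {:V})%N.
Proof.
have kerS : (lker f <= f @^-1: S)%VS.
  by apply/subvP => v; rewrite memv_ker -memv_preim => /eqP ->; exact: mem0v.
have imgS : (f @: (f @^-1: S) = S :&: limg f)%VS.
  by rewrite -lpreim_cap_limg lpreimK // capvSr.
have := limg_ker_dim f (f @^-1: S); rewrite imgS (capv_idPr kerS) => <-.
have := limg_ker_dim f fullv; rewrite capfv => <-.
rewrite -!addnA leq_add2l addnC -dimv_sum_cap addnC leq_add2l.
exact/dimvS/subvf.
Qed.

Lemma stable_preim f (a : 'End(V)) (a' : 'End(U)) S :
    ((a \o f) - (f \o a'))%VF = 0 ->
  (a @: S <= S)%VS -> (a' @: (f @^-1: S) <= f @^-1: S)%VS.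
Proof.
move=> /eqP; rewrite subr_eq0 => /eqP afE aS.
apply/subvP => _ /memv_imgP [v + ->]; rewrite -!memv_preim => fvS.
have <- : a (f v) = f (a' v) by rewrite -!comp_lfunE afE.
exact/(subvP aS)/memv_img.
Qed.

End LinearAlgebra.

(** Over a subrepresentation (T, S) of the ADHM part, the preimage of S under F
    is the largest possible V'-component; the relations AF = FA' and BF = FB'
    make it invariant. *)
Lemma pullback_subrep (R : realType) (r c c' : nat) (X : eadhm_rep R r c c')
    (T : {vspace repW X}) (S : {vspace repV X}) :
    (mapA X @: S <= S)%VS -> (mapB X @: S <= S)%VS ->
    (mapI X @: T <= S)%VS -> (mapJ X @: S <= T)%VS ->
  exists Y : subrep X,
    [/\ subW Y = T, subV Y = S & subV' Y = (mapF X @^-1: S)%VS].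
Proof.
move=> AS BS IT JS.
have FS : (mapF X @: (mapF X @^-1: S) <= S)%VS.
  by apply/subvP => _ /memv_imgP [v + ->]; rewrite -memv_preim.
by exists (Subrep AS BS IT JS (stable_preim (eqAF X) AS)
             (stable_preim (eqBF X) BS) FS).
Qed.

Section Chamber.
Variables (R : realType) (r c c' : nat) (X : eadhm_rep R r c c').
Variables (theta theta' thetaoo : R).
Hypothesis hTheta : c%:R * theta + c'%:R * theta' + r%:R * thetaoo = 0.
Hypothesis htheta' : 0 < theta'.
Hypothesis hsum : theta + theta' < 0.

(** Read s and s' as the dimensions of S and of its preimage under F: the
    second hypothesis is then the bound on the codimension of a preimage, and
    the weight is at least - (theta + theta') * (c - s). *)
Lemma weight_gt0 (s s' : nat) : (s < c)%N -> (c' + s <= s' + c)%N ->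
  0 < thetaoo * r%:R + theta * s%:R + theta' * s'%:R.
Proof.
rewrite -(ltr_nat R) -(ler_nat R) !natrD => lt_sc codim.
move: hTheta htheta' hsum => weight0 theta'_gt0 sum_lt0.
have : 0 < (- (theta + theta')) * (c%:R - s%:R) by apply: mulr_gt0; lra.
have : 0 <= theta' * (s'%:R + c%:R - (c'%:R + s%:R)) by apply: mulr_ge0; lra.
lra.
Qed.

Lemma stable_semistable :
  theta_stable X theta theta' thetaoo -> theta_semistable X theta theta' thetaoo.
Proof.
by move=> [st0 str]; split=> Y d d' nY tY; apply: ltW;
  [exact: st0 nY tY | exact: str nY tY].
Qed.

Lemma semistable_injF :
  theta_semistable X theta theta' thetaoo -> injective (mapF X).
Proof.
move=> [sst0 _].
have [|||| Y [YW YV YV']] := @pullback_subrep _ _ _ _ X 0%VS 0%VS;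
  rewrite ?limg0 ?subvv //.
have kerE : (mapF X @^-1: 0 = lker (mapF X))%VS.
  by apply/vspaceP => v; rewrite -memv_preim memv0 memv_ker.
rewrite kerE in YV'.
apply/lker0P; apply: contraT => ker_neq0.
have nY : ~ subrep_zero Y by case=> _ _ /eqP; rewrite YV' (negPf ker_neq0).
have := sst0 Y 0%N (\dim (lker (mapF X))) nY.
rewrite /numtype YW YV YV' !dimv0 mulr0 add0r => /(_ erefl).
by rewrite pmulr_rle0 // lern0 dimv_eq0 (negPf ker_neq0).
Qed.

Lemma semistable_adhm_stable :
    theta_semistable X theta theta' thetaoo ->
  adhm_stable (mapA X) (mapB X) (mapI X) (mapJ X).
Proof.
move=> [_ sstr] [S [S_proper AS BS IS]].
have [|||| Y [YW YV YV']] := @pullback_subrep _ _ _ _ X fullv S;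
  rewrite ?subvf //.
have nY : ~ subrep_full Y by case=> _ /eqP; rewrite YV (negPf S_proper).
have := sstr Y (\dim S) (\dim (mapF X @^-1: S)) nY.
rewrite /numtype YW YV YV' dim_repW => /(_ erefl).
have ltSc : (\dim S < c)%N.
  by move: S_proper; rewrite eqEdim subvf dim_repV -ltnNge.
have := codim_preim (mapF X) S; rewrite dim_repV dim_repV'.
by move=> /(weight_gt0 ltSc) /lt_geF ->.
Qed.

Lemma injF_adhm_stable_stable :
    injective (mapF X) -> adhm_stable (mapA X) (mapB X) (mapI X) (mapJ X) ->
  theta_stable X theta theta' thetaoo.
Proof.
move=> /lker0P kerF adhm_st; split=> Y d d' nY [dW <- <-].
  have led : (\dim (subV' Y) <= \dim (subV Y))%N.
    by rewrite -(limg_dim_eq (f := mapF X)) ?dimvS ?subrepF // (eqP kerF) capv0.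
  have d_gt0 : (0 < \dim (subV Y))%N.
    rewrite lt0n; apply/eqP => d0; apply: nY.
    move: led; rewrite d0 leqn0 => d'0.
    by split; apply/eqP; rewrite -dimv_eq0 ?dW ?d0.
  move: led d_gt0; rewrite -(ler_nat R) -(ltr_nat R).
  set s := (\dim (subV Y))%:R; set s' := (\dim _)%:R => led d_gt0.
  have : (theta + theta') * s < 0 by rewrite nmulr_rlt0.
  have : theta' * s' <= theta' * s by rewrite ler_pM2l.
  lra.
have WE : subW Y = fullv.
  by apply/eqP; rewrite eqEdim subvf dW dim_repW leqnn.
have VE : subV Y = fullv.
  apply/eqP; apply: contraT => S_proper; case: adhm_st; exists (subV Y).
  by split; rewrite ?subrepA ?subrepB // -WE subrepI.
have : (\dim (subV' Y) < c')%N.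
  rewrite ltnNge; apply/negP => led'; apply: nY; split=> //.
  by apply/eqP; rewrite eqEdim subvf dim_repV'.
rewrite VE dim_repV -(ltr_nat R) -(ltr_pM2l htheta').
move: hTheta; lra.
Qed.

End Chamber.

Theorem lemma2 (R : realType) (r c c' : nat)
    (hr : (0 < r)%N) (hc : (0 < c)%N) (hc' : (0 < c')%N)
    (theta theta' thetaoo : R)
    (hTheta : c%:R * theta + c'%:R * theta' + r%:R * thetaoo = 0)
    (htheta' : 0 < theta') (hsum : theta + theta' < 0)
    (X : eadhm_rep R r c c') :
  [<-> theta_stable X theta theta' thetaoo;
       theta_semistable X theta theta' thetaoo;
       injective (mapF X) /\
         adhm_stable (mapA X) (mapB X) (mapI X) (mapJ X)].
Proof.
tfae.
- exact: stable_semistable.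
- by move=> sst; split; [exact: semistable_injF sst
                        | exact: semistable_adhm_stable sst].
- by case; exact: injF_adhm_stable_stable.
Qed.
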